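(* Let $k\in\mathbf{N}$ and let $X$ be a normed space. In the balancing game with parameters $k$ and $X$ (described in the context), Player II can keep the sequence $(p_i)_{i\in\mathbf{N}}$ bounded if and only if $X$ is at most two-dimensional and $k$ is even. In fact, when $X$ is at most two-dimensional and $k$ is even, Player II can force $\|p_i\|\leq 2$ for all $i\in\mathbf{N}$.
   Context: $\mathbf{N}$ denotes the positive integers. The balancing game is the following two-player perfect information game. Fix $k\in\mathbf{N}$ and a (real) normed space $X$ with norm $\|\cdot\|$. The starting position is $p_0=o$, the zero vector of $X$. In round $i$ ($i=1,2,3,\dots$), Player I, knowing everything that has happened so far, chooses $k$ unit vectors $x_1,\dots,x_k$ in $X$ (not necessarily distinct), and then Player II, knowing the history and these vectors, chooses signs $\varepsilon_1,\dots,\varepsilon_k\in\{\pm 1\}$. The position is then adjusted to $p_i := p_{i-1}+\sum_{j=1}^k\varepsilon_j x_j$. ''Player II can keep the sequence bounded'' means that Player II has a strategy such that, however Player I plays, the resulting sequence $(p_i)_{i\in\mathbf{N}}$ is bounded in norm. ''Player II can force $\|p_i\|\leq 2$ for all $i$'' means that Player II has a strategy such that, however Player I plays, $\|p_i\|\le 2$ for all $i\in\mathbf{N}$.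
   Formalization: The case where X has dimension at most 1 and k is odd is excluded: on a line all unit vectors are equal up to sign, so Player II can keep every position within norm 1 even for odd k, and in the zero space there are no unit vectors, so the stated equivalence fails there. *)

(* Defs.v *)
From HB Require Import structures.
From mathcomp Require Import all_boot all_order all_algebra.
From mathcomp Require Import all_classical all_reals all_analysis.
Import Order.TTheory GRing.Theory Num.Theory numFieldNormedType.Exports.

Set Implicit Arguments.
Unset Strict Implicit.
Unset Printing Implicit Defensive.

Local Open Scope classical_set_scope.
Local Open Scope ring_scope.

Definition is_basis (R : realType) (X : normedModType R) (m : nat)
    (e : 'I_m -> X) : Prop :=
  forall x : X, exists! c : 'rV[R]_m, x = \sum_(i < m) c 0 i *: e i.

Definition dim_at_most (R : realType) (X : normedModType R) (n : nat) : Prop :=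
  exists m : nat, (m <= n)%N /\ exists e : 'I_m -> X, is_basis e.

(* One round of the balancing game: the k vectors chosen by Player I, then the
   k signs chosen by Player II; a boolean b stands for the sign (-1) ^+ b. *)
Definition round (R : realType) (X : normedModType R) (k : nat) : Type :=
  (k.-tuple X * k.-tuple bool)%type.

(* Rounds are numbered from 0: [play i] is round i + 1 of the game, which leads
   from [position play i] to [position play i.+1]. *)
Fixpoint position (R : realType) (X : normedModType R) (k : nat)
    (play : nat -> round X k) (n : nat) : X :=
  if n is i.+1 then
    position play i +
      \sum_(j < k) (-1) ^+ (tnth (play i).2 j) *: tnth (play i).1 j
  else 0.

Definition legal (R : realType) (X : normedModType R) (k : nat)
    (play : nat -> round X k) : Prop :=
  forall (i : nat) (j : 'I_k), `|tnth (play i).1 j| = 1.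

(* A strategy for Player II maps the list of all previous rounds and the
   vectors just chosen by Player I to signs. *)
Definition strategy (R : realType) (X : normedModType R) (k : nat) : Type :=
  seq (round X k) -> k.-tuple X -> k.-tuple bool.

Definition follows (R : realType) (X : normedModType R) (k : nat)
    (sigma : strategy X k) (play : nat -> round X k) : Prop :=
  forall i : nat, (play i).2 = sigma (mkseq play i) (play i).1.

Definition playerII_can_force (R : realType) (X : normedModType R) (k : nat)
    (P : (nat -> X) -> Prop) : Prop :=
  exists sigma : strategy X k, forall play : nat -> round X k,
    legal play -> follows sigma play -> P (position play).

Definition playerII_can_keep_bounded (R : realType) (X : normedModType R)
    (k : nat) : Prop :=
  playerII_can_force k (fun p : nat -> X => bounded_fun p).

(* Main.v *)
(** Player II, k even: pair up the vectors. If [`|p| <= 2] and x, y are unit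
    vectors spanning p, flip their signs and order them so that p = a x + b y
    with 0 <= b <= a; then [`|p - x - y| <= 2]. If x, y do not span p, then
    y = x or y = - x, and the pair can be made to cancel.

    Player I: transport the standard inner product to the span of n independent
    vectors of X. Every sum u of signed vectors of a round is made orthogonal to
    the current position and bounded below, so that the squared Euclidean length
    of the position grows linearly. If k is odd and n = 2, all the vectors are
    one unit vector w orthogonal to the position, and u is an odd multiple of w.
    If n = 3, one vector is w and the k - 1 others are v, with v and w orthogonal
    to each other and to the position, so that the component of u along w is
    w or - w. *)

Require Import Defs.
From HB Require Import structures.
From mathcomp Require Import all_boot all_order all_algebra.
From mathcomp Require Import all_classical all_reals all_analysis.
From mathcomp Require Import ring lra zify.
Import Order.TTheory GRing.Theory Num.Theory numFieldNormedType.Exports.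

Set Implicit Arguments.
Unset Strict Implicit.
Unset Printing Implicit Defensive.

Local Open Scope classical_set_scope.
Local Open Scope ring_scope.

(** * Positional strategies and plays *)

Section Game.
Variables (R : realType) (X : normedModType R) (k : nat).
Implicit Types (p : X) (xs : k.-tuple X) (bs : k.-tuple bool).

Definition displacement (r : round X k) : X :=
  \sum_(j < k) (-1) ^+ (tnth r.2 j) *: tnth r.1 j.

Lemma position_mkseq (play : nat -> round X k) (n : nat) :
  position play n = \sum_(r <- mkseq play n) displacement r.
Proof.
elim: n => [|n IHn]; first by rewrite big_nil.
by rewrite mkseqS -cats1 big_cat big_seq1 /= IHn.
Qed.

(** Player II can play positionally: the history determines the position, and [g] picks signs that
    preserve [P]. *)
Lemma force_invariant (P : X -> Prop) :
  P 0 ->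
  (forall p xs, P p -> (forall j, `|tnth xs j| = 1) ->
     exists bs, P (p + displacement (xs, bs))) ->
  playerII_can_force k (fun p : nat -> X => forall i, P (p i)).
Proof.
move=> P0 Pstep.
have /choice[g gP] (z : X * k.-tuple X) : exists bs,
    P z.1 -> (forall j, `|tnth z.2 j| = 1) -> P (z.1 + displacement (z.2, bs)).
  case: (pselect (P z.1 /\ forall j, `|tnth z.2 j| = 1)) => [[Pz uz]|nPz].
    by have [bs Pbs] := Pstep _ _ Pz uz; exists bs.
  (* Off [P], or against illegal vectors, any signs do. *)
  by exists [tuple false | j < k] => Pz uz; case: nPz.
exists (fun h xs => g (\sum_(r <- h) displacement r, xs)) => play lp fp.
elim=> [//|i IHi].
have := gP (position play i, (play i).1) IHi (lp i).
by move: (fp i); rewrite -position_mkseq => <-.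
Qed.

(** Player I follows a rule [f] that looks only at the position. The play is built through its list
    of earlier rounds, because [sigma] may consult the whole history. *)
Lemma strategy_challenge (f : X -> k.-tuple X) (sigma : strategy X k) :
  exists2 play, follows sigma play &
    forall i, (play i).1 = f (position play i).
Proof.
pose next h := let xs := f (\sum_(r <- h) displacement r) in (xs, sigma h xs).
pose hist := fix hist n := if n is m.+1 then rcons (hist m) (next (hist m))
                           else [::].
pose play i := next (hist i).
have histE i : hist i = mkseq play i.
  by elim: i => // i IHi; rewrite mkseqS -IHi.
exists play => i; first by rewrite /play histE.
by rewrite position_mkseq -histE.
Qed.

End Game.

(** * Coordinates versus norm on a finite-dimensional span *)

Section LinearCombinations.
Variables (R : realType) (X : normedModType R) (n : nat) (e : 'I_n -> X).
Implicit Types c : 'rV[R]_n.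

Definition lincomb c : X := \sum_(i < n) c 0 i *: e i.

Lemma lincomb_is_linear : linear lincomb.
Proof.
move=> a u v; rewrite /lincomb scaler_sumr -big_split /=.
by apply: eq_bigr => i _; rewrite !mxE scalerDl scalerA.
Qed.

HB.instance Definition _ :=
  GRing.isLinear.Build R 'rV[R]_n X *:%R lincomb lincomb_is_linear.

Definition independent : Prop := forall c, lincomb c = 0 -> c = 0.

Lemma mx_entry_le_norm c i : `|c 0 i| <= `|c|.
Proof.
rewrite /Num.norm/= mx_normrE.
exact: (le_bigmax _ (fun ij => `|c ij.1 ij.2|) (0, i)).
Qed.

Lemma lincomb_norm_le : exists2 S, 0 < S & forall c, `|lincomb c| <= S * `|c|.
Proof.
exists (1 + \sum_(i < n) `|e i|) => [|c].
  by rewrite ltr_wpDr// sumr_ge0.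
apply: le_trans (ler_norm_sum _ _ _) _.
rewrite mulrDl mul1r mulr_suml ler_wpDl//; apply: ler_sum => i _.
by rewrite normrZ mulrC ler_wpM2l// mx_entry_le_norm.
Qed.

Lemma lincomb_continuous : continuous lincomb.
Proof.
apply: continuous_big => [|i _ c]; first exact: add_continuous.
apply: (@cvgZr_tmp _ _ _ (nbhs c) (nbhs_filter c)); exact: coord_continuous.
Qed.

(** On the compact unit sphere the norm of [lincomb c] attains a minimum, positive by independence;
    homogeneity extends the bound to all [c]. *)
Lemma lincomb_norm_ge : independent ->
  exists2 K, 0 < K & forall c, `|c| <= K * `|lincomb c|.
Proof.
move=> ind.
pose S := [set c : 'rV[R]_n | `|c| = 1].
have bS : bounded_set S.
  by exists 1; split=> // M M1 c; rewrite /S/= => ->; exact: ltW.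
have cS : closed S.
  apply: (closed_comp (f := fun c : 'rV[R]_n => `|c|) (D := [set 1])).
    by move=> c _; exact: norm_continuous.
  exact: closed_eq.
(* An empty sphere leaves only [c = 0]; this covers [n = 0]. *)
have [S0|/set0P S0] := eqVneq S set0.
  exists 1 => // c; have [->|c0] := eqVneq c 0; first by rewrite normr0 mulr_ge0.
  suff : S (`|c|^-1 *: c) by rewrite S0.
  by rewrite /S/= normrZ normfV normr_id mulVf// normr_eq0.
have [|c0 /set_mem Sc0 minc0] := EVT_min_rV (f := fun c => `|lincomb c|) S0
   (bounded_closed_compact bS cS).
  apply: continuous_subspaceT => c.
  by apply: (continuous_comp (@lincomb_continuous c)); exact: norm_continuous.
have pos : 0 < `|lincomb c0|.
  rewrite normr_gt0; apply/eqP => /ind c00.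
  by move: Sc0; rewrite /S/= c00 normr0 => /esym/eqP; rewrite oner_eq0.
exists `|lincomb c0|^-1 => [|c]; first by rewrite invr_gt0.
have [->|cn0] := eqVneq c 0; first by rewrite normr0 mulr_ge0// invr_ge0.
have cpos : 0 < `|c| by rewrite normr_gt0.
rewrite ler_pdivlMl//.
have : `|c|^-1 *: c \in S.
  by apply/mem_set; rewrite /S/= normrZ normfV normr_id mulVf// gt_eqF.
move=> /minc0; rewrite linearZ normrZ normfV normr_id.
by rewrite ler_pdivlMl// mulrC.
Qed.

End LinearCombinations.

(** * Kernel vectors and sums of signs *)

Lemma left_kernel_vector (F : fieldType) (n m : nat) (A : 'M[F]_(n, m)) :
  (m < n)%N -> exists2 w : 'rV[F]_n, w != 0 & w *m A = 0.
Proof.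
move=> mn; have : kermx A != 0.
  by rewrite kermx_eq0 /row_free neq_ltn (leq_ltn_trans (rank_leq_col A) mn).
by case/rowV0Pn => w /sub_kermxP wA w0; exists w.
Qed.

Lemma sum_signs (R : pzRingType) (k : nat) (b : 'I_k -> bool) :
  \sum_(j < k) (-1) ^+ b j = k%:R - (\sum_(j < k) b j).*2%:R :> R.
Proof.
rewrite -muln2 natrM natr_sum mulr_suml -[in k%:R](card_ord k) -sum1_card natr_sum.
rewrite -sumrB; apply: eq_bigr => j _; case: (b j) => /=.
  by rewrite expr1 mul1r opprD addNKr.
by rewrite expr0 mul0r subr0.
Qed.

(** The sum is an odd integer, hence nonzero. *)
Lemma odd_sum_signs_sqr_ge1 (R : realDomainType) (k : nat) (b : 'I_k -> bool) :
  odd k -> 1 <= (\sum_(j < k) (-1) ^+ b j) ^+ 2 :> R.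
Proof.
move=> ok; rewrite sum_signs; move: (\sum_(j < k) b j)%N => m.
have -> : k%:R - m.*2%:R = (k%:Z - m.*2%:Z)%:~R :> R by rewrite rmorphB.
rewrite -rmorphXn /= ler1z ; nia.
Qed.

(** * Balancing two unit vectors that span the position *)

Section Parallelogram.
Variables (R : realType) (X : normedModType R).
Implicit Types (p x y : X) (a b : R).

(* The case 1 < a: since x = a^-1 (p - b y) has norm 1, a <= 1 + b, and
   p - (x + y) / 2 = (1 - (2 a)^-1) p - (a - b) / (2 a) y. *)
Lemma half_diagonal p x y a b : `|x| = 1 -> `|y| = 1 -> `|p| <= 1 ->
  p = a *: x + b *: y -> 0 <= b -> b <= a ->
  `|p - 2^-1 *: (x + y)| <= 1.
Proof.
move=> x1 y1 p1 pE b0 ba.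
have [a1|a1] := leP a 1.
  have -> : p - 2^-1 *: (x + y) = (a - 2^-1) *: x + (b - 2^-1) *: y.
    by rewrite pE !scalerBl scalerDr opprD addrACA.
  (* Both coefficients lie between -1/2 and 1/2. *)
  apply: le_trans (ler_normD _ _) _; rewrite !normrZ x1 y1 !mulr1.
  case: (lerP 0 (a - 2^-1)) => h1; case: (lerP 0 (b - 2^-1)) => h2;
    by rewrite ?(ger0_norm h1) ?(ltr0_norm h1) ?(ger0_norm h2) ?(ltr0_norm h2); lra.
have a0 : 0 < a by lra.
have ab : a <= 1 + b.
  have : `|a *: x| <= `|p| + `|b *: y|.
    by rewrite -[a *: x](addrK (b *: y)) -pE ler_normB.
  by rewrite !normrZ x1 y1 !mulr1 (gtr0_norm a0) (ger0_norm b0); lra.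
have -> : p - 2^-1 *: (x + y) =
    (1 - (2 * a)^-1) *: p - ((a - b) * (2 * a)^-1) *: y.
  have -> : 2^-1 *: (x + y) =
      (2 * a)^-1 *: (a *: x + b *: y) + ((a - b) * (2 * a)^-1) *: y.
    rewrite !scalerDr !scalerA -addrA -scalerDl.
    by congr (_ *: _ + _ *: _); field; rewrite gt_eqF.
  by rewrite scalerBl scale1r -pE opprD addrA.
have inv0 : 0 < (2 * a)^-1 by rewrite invr_gt0; lra.
have inv1 : a * (2 * a)^-1 = 2^-1 by field; rewrite gt_eqF.
apply: le_trans (ler_normB _ _) _; rewrite 2!normrZ y1 mulr1.
have t0 : 0 <= 1 - (2 * a)^-1 by nra.
have s0 : 0 <= (a - b) * (2 * a)^-1 by rewrite mulr_ge0 ?subr_ge0// ltW.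
rewrite (ger0_norm t0) (ger0_norm s0).
(* By [ab], [a - b <= 1], so the two coefficients add up to at most 1. *)
have := ler_wpM2l t0 p1; nra.
Qed.

(** This is [half_diagonal] scaled by 2, after a swap and sign changes that make the coefficients
    nonnegative and ordered. *)
Lemma balance_pair_span p x y a b : `|x| = 1 -> `|y| = 1 -> `|p| <= 2 ->
  p = a *: x + b *: y ->
  exists s t : bool, `|p + ((-1) ^+ s *: x + (-1) ^+ t *: y)| <= 2.
Proof.
wlog ba : x y a b / `|b| <= `|a|.
  move=> W x1 y1 p2 pE; have [/W|/ltW /W] := leP `|b| `|a|; first exact.
  move=> /(_ y x y1 x1 p2); rewrite addrC => /(_ pE)[s [t st]].
  by exists t, s; rewrite [_ *: x + _]addrC.
move=> x1 y1 p2 pE.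
(* As [true] stands for -1, these signs oppose those of [a] and [b]: [p = |a| x' + |b| y'] moves to
   [p - (x' + y')]. *)
exists (0 <= a), (0 <= b).
set x' := (-1) ^+ (a < 0)%R *: x; set y' := (-1) ^+ (b < 0)%R *: y.
have -> : (-1) ^+ (0 <= a)%R *: x + (-1) ^+ (0 <= b)%R *: y = - (x' + y').
  rewrite /x' /y' !leNgt opprD; congr (_ + _);
    by case: (_ < 0); rewrite ?scale1r ?scaleN1r ?opprK.
have h2 : 0 < 2^-1 :> R by rewrite invr_gt0.
have := @half_diagonal (2^-1 *: p) x' y' (2^-1 * `|a|) (2^-1 * `|b|).
rewrite -scalerBr !normrZ !normr_sign !mul1r x1 y1 (gtr0_norm h2).
rewrite !ler_pdivrMl// !mulr1; apply=> //.
- rewrite -!scalerA -scalerDr /x' /y' !scalerA pE.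
  by rewrite ![`|_| * _]mulrC -!numEsign.
- by rewrite mulVKf.
Qed.

End Parallelogram.

(** * Linear dependence and Player II's moves *)

Section Dimension.
Variables (R : realType) (X : normedModType R).

(** An independent family of at most [n] vectors is not a basis, so a vector outside its span can be
    added. *)
Lemma independent_of_dim (n : nat) :
  ~ dim_at_most X n -> exists e : 'I_n.+1 -> X, independent e.
Proof.
move=> dn; suff : forall m, (m <= n.+1)%N -> exists e : 'I_m -> X, independent e.
  exact.
elim=> [|m IHm] mn.
  by exists (fun=> 0) => c _; apply/rowP => -[].
have [e ie] := IHm (ltnW mn).
have [x xe] : exists x, forall c, x <> lincomb e c.
  apply: contrapT => /forallNP H; apply: dn; exists m; split=> //; exists e => x.
  have /existsNP[c /contrapT xc] := H x; exists c; split=> // c' xc'.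
  apply/eqP; rewrite -subr_eq0; apply/eqP/ie.
  by rewrite linearB /= -xc -[lincomb e c']xc' subrr.
exists (fun i => if unlift ord_max i is Some j then e j else x) => c.
rewrite /lincomb big_ord_recr /= unlift_none.
under eq_bigr => i _.
  have -> : widen_ord (leqnSn m) i = lift ord_max i.
    by apply: val_inj; rewrite /= /bump leqNgt ltn_ord.
  rewrite liftK; over.
pose c' := \row_i c 0 (lift ord_max i).
have -> : \sum_(i < m) c 0 (lift ord_max i) *: e i = lincomb e c'.
  by apply: eq_bigr => i _; rewrite mxE.
(* Dividing by a nonzero last coefficient would put [x] in the span of [e]. *)
move=> cE; have cm0 : c 0 ord_max = 0.
  apply/eqP; apply: contra_notT (xe (- (c 0 ord_max)^-1 *: c')) => cm.
  rewrite linearZ /= scaleNr -scalerN; move/eqP: cE; rewrite addrC addr_eq0.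
  move=> /eqP <-; by rewrite scalerA mulVf// scale1r.
move: cE; rewrite cm0 scale0r addr0 => /ie c'0.
apply/rowP => i; rewrite mxE; case: (unliftP ord_max i) => [j|] -> //.
by move/rowP: c'0 => /(_ j); rewrite !mxE.
Qed.

(** The coordinates of the [v i] in a basis form a matrix with more rows than columns; a left kernel
    vector of it is a linear dependence. *)
Lemma dim_at_most_dependent (n m : nat) (v : 'I_m -> X) :
  dim_at_most X n -> (n < m)%N -> ~ independent v.
Proof.
move=> [d [dn [e be]]] nm iv.
have /choice[a va] : forall i, exists c, v i = lincomb e c.
  by move=> i; have [c [vc _]] := be (v i); exists c.
have [w w0 wA] := @left_kernel_vector R m d (\matrix_i a i) (leq_ltn_trans dn nm).
move/eqP: w0; apply; apply: iv.
have : lincomb e (w *m \matrix_i a i) = 0 by rewrite wA linear0.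
rewrite mulmx_sum_row linear_sum /= => <-; apply: eq_bigr => i _.
by rewrite linearZ /= rowK va.
Qed.

Lemma balance_pair (p x y : X) : dim_at_most X 2 ->
  `|x| = 1 -> `|y| = 1 -> `|p| <= 2 ->
  exists s t : bool, `|p + ((-1) ^+ s *: x + (-1) ^+ t *: y)| <= 2.
Proof.
move=> d2 x1 y1 p2.
have /existsNP[c /not_implyP[c0 cn0]] :=
  dim_at_most_dependent (v := tnth [tuple p; x; y]) d2 isT.
move: c0; rewrite /lincomb !big_ord_recl big_ord0 addr0 !(tnth_nth 0) /=.
set c0 := c 0 ord0; set c1 := c 0 _; set c2 := c 0 _ => cE.
have [c00|c00] := eqVneq c0 0; last first.
  apply: (@balance_pair_span _ _ _ _ _ (- (c0^-1 * c1)) (- (c0^-1 * c2))) => //.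
  have -> : p = c0^-1 *: (c0 *: p) by rewrite scalerA mulVf// scale1r.
  move/eqP: cE; rewrite addr_eq0 => /eqP ->.
  by rewrite scalerN scalerDr !scalerA opprD !scaleNr.
move: cE; rewrite c00 scale0r add0r => cE.
have c12 : `|c1| = `|c2|.
  move/eqP: cE; rewrite addr_eq0 => /eqP /(congr1 Num.norm).
  by rewrite normrN !normrZ x1 y1 !mulr1.
have c10 : c1 != 0.
  apply: contra_notN cn0 => /eqP c10; have c20 : c2 = 0.
    by apply/eqP; rewrite -normr_eq0 -c12 c10 normr0.
  apply/rowP => i; rewrite mxE.
  case: (unliftP ord0 i) => [j ->|->//]; case: (unliftP ord0 j) => [l ->|->//].
  by rewrite [l]ord1.
(* Since [|c1| = |c2|], dividing [cE] by [|c1|] leaves a signed sum of [x] and [y] equal to 0. *)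
exists (c1 < 0)%R, (c2 < 0)%R.
suff -> : (-1) ^+ (c1 < 0)%R *: x + (-1) ^+ (c2 < 0)%R *: y = 0 by rewrite addr0.
apply: (scalerI (a := `|c1|)); first by rewrite normr_eq0.
rewrite scaler0 scalerDr !scalerA {2}c12 ![`|_| * _]mulrC -!numEsign; exact: cE.
Qed.

Lemma balance_even (k : nat) (p : X) (xs : k.-tuple X) : dim_at_most X 2 ->
  ~~ odd k -> `|p| <= 2 -> (forall j, `|tnth xs j| = 1) ->
  exists bs, `|p + displacement (xs, bs)| <= 2.
Proof.
move=> d2; elim/ltn_ind: k p xs => -[|[|k]] IHk p xs // ok p2 xs1.
  by exists [tuple]; rewrite /displacement big_ord0 addr0.
case/tupleP: xs xs1 => x xs; case/tupleP: xs => y xs xs1.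
have [s [t st]] := balance_pair d2 (xs1 ord0) (xs1 (lift ord0 ord0)) p2.
have [||//|bs] := IHk k _ _ xs _ st; [by []|by rewrite /= negbK in ok|..].
  by move=> j; rewrite -(xs1 (lift ord0 (lift ord0 j))) !tnthS.
move=> bsP; exists [tuple of s :: t :: bs]; move: bsP.
rewrite /displacement !big_ord_recl /= !tnthS !tnth0 -!addrA.
by under [X in _ -> `|_ + (_ + (_ + X))| <= _]eq_bigr do rewrite !tnthS.
Qed.

End Dimension.

(** * The transported inner product and unbounded growth *)

Section Escape.
Variables (R : realType) (X : normedModType R) (n : nat).
Implicit Types u v w c : 'rV[R]_n.

Definition dot u v : R := (u *m v^T) 0 0.

Lemma dotC u v : dot u v = dot v u.
Proof. by rewrite /dot -[u in LHS]trmxK -trmx_mul mxE. Qed.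

Lemma dotDl u v w : dot (u + v) w = dot u w + dot v w.
Proof. by rewrite /dot mulmxDl mxE. Qed.

Lemma dotZl a u v : dot (a *: u) v = a * dot u v.
Proof. by rewrite /dot -scalemxAl mxE. Qed.

Lemma dotDr u v w : dot w (u + v) = dot w u + dot w v.
Proof. by rewrite dotC dotDl !(dotC w). Qed.

Lemma dotZr a u v : dot v (a *: u) = a * dot v u.
Proof. by rewrite dotC dotZl dotC. Qed.

Lemma dot_sqr u : dot u u = \sum_(i < n) u 0 i ^+ 2.
Proof. by rewrite /dot mxE; apply: eq_bigr => i _; rewrite mxE expr2. Qed.

Lemma norm_sqr_le_dot u : `|u| ^+ 2 <= dot u u.
Proof.
rewrite dot_sqr; have [->|u0] := eqVneq u 0.
  by rewrite normr0 expr0n /= sumr_ge0// => i _; rewrite sqr_ge0.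
have : mx_norm u != 0 by rewrite -[mx_norm u]/(`|u|) normr_eq0.
move=> /mx_norm_neq0[[j i]]; rewrite [j]ord1 /= -[mx_norm u]/(`|u|) => ->.
rewrite real_normK ?num_real// (bigD1 i)//= lerDl.
by apply: sumr_ge0 => l _; rewrite sqr_ge0.
Qed.

Lemma dot_le_norm_sqr u : dot u u <= n%:R * `|u| ^+ 2.
Proof.
rewrite dot_sqr -[n in n%:R]card_ord mulr_natl -sumr_const.
apply: ler_sum => i _; rewrite -(real_normK (num_real (u 0 i))).
by rewrite ler_pXn2r ?nnegrE//; exact: mx_entry_le_norm.
Qed.

Variable e : 'I_n -> X.
Hypothesis ind : independent e.

(** The bound [d] depends only on [e]: a combination of norm 1 has coordinates of norm at least
    [S^-1]. Every round can thus gain the same amount. *)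
Lemma unit_orthogonal : exists2 d, 0 < d & forall (m : nat) (A : 'M[R]_(n, m)),
  (m < n)%N -> exists w, [/\ w *m A = 0, `|lincomb e w| = 1 & d <= dot w w].
Proof.
have [S S0 eS] := lincomb_norm_le e.
exists (S^-1 ^+ 2) => [|m A mn]; first by rewrite exprn_gt0 ?invr_gt0.
have [w w0 wA] := left_kernel_vector A mn.
have ew0 : lincomb e w != 0 by apply: contra_neq w0 => /ind.
set w' := `|lincomb e w|^-1 *: w.
have w'1 : `|lincomb e w'| = 1.
  by rewrite linearZ /= normrZ normfV normr_id mulVf// normr_eq0.
exists w'; split=> //; first by rewrite -scalemxAl wA scaler0.
apply: le_trans (norm_sqr_le_dot w').
rewrite ler_pXn2r ?nnegrE ?invr_ge0 ?(ltW S0)// -[S^-1]mulr1 ler_pdivrMl//.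
by rewrite -w'1.
Qed.

(** By Pythagoras each round adds at least [d] to [dot c c], whereas bounded positions would bound
    [dot c c] through [lincomb_norm_ge]. *)
Lemma not_keep_bounded (k : nat) (d : R) : 0 < d ->
  (forall c, exists xs : k.-tuple X, (forall j, `|tnth xs j| = 1) /\
     forall bs, exists u,
       [/\ displacement (xs, bs) = lincomb e u, dot u c = 0 & d <= dot u u]) ->
  ~ playerII_can_keep_bounded X k.
Proof.
move=> d0 move_c [sigma bounded_sigma].
have /choice[f fP] (p : X) : exists xs : k.-tuple X,
    (forall j, `|tnth xs j| = 1) /\ forall c, p = lincomb e c ->
     forall bs, exists u,
       [/\ displacement (xs, bs) = lincomb e u, dot u c = 0 & d <= dot u u].
  have [[c ->]|nc] := pselect (exists c, p = lincomb e c).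
    have [xs [xs1 xsc]] := move_c c; exists xs; split=> // c' /eqP.
    by rewrite -subr_eq0 -linearB => /eqP/ind/eqP; rewrite subr_eq0 => /eqP <-.
  (* Outside the span of [e], which the play never reaches, any legal move serves as a default. *)
  have [xs [xs1 _]] := move_c 0; exists xs; split=> // c pc.
  by case: nc; exists c.
have [play sigma_play playE] := strategy_challenge f sigma.
have legal_play : legal play by move=> i j; rewrite playE; exact: (fP _).1.
have [N [_ posN]] := bounded_sigma _ legal_play sigma_play.
have posM i : `|position play i| <= N + 1.
  by apply: posN => //; rewrite ltrDl.
move: (N + 1) posM => M posM.
have grow i : exists2 c, position play i = lincomb e c & d *+ i <= dot c c.
  elim: i => [|i [c pc dc]].
    exists 0; rewrite ?linear0// mulr0n.
    by rewrite (le_trans (sqr_ge0 `|0 : 'rV[R]_n|))// norm_sqr_le_dot.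
  have [u [uE uc du]] := (fP _).2 c pc (play i).2.
  exists (c + u); first by rewrite linearD /= -pc -uE -playE.
  rewrite dotDl !dotDr uc (dotC c) uc add0r addr0 mulrSr.
  exact: lerD.
have [K K0 eK] := lincomb_norm_ge ind.
pose B := n%:R * (K * M) ^+ 2.
have dB i : d *+ i <= B.
  have [c pc dc] := grow i; apply: (le_trans dc).
  apply: le_trans (dot_le_norm_sqr c) _; rewrite ler_wpM2l//.
  have Mi : `|lincomb e c| <= M by rewrite -pc; exact: posM.
  have M0 : 0 <= M := le_trans (normr_ge0 _) Mi.
  rewrite ler_pXn2r ?nnegrE ?mulr_ge0 ?(ltW K0)//.
  by apply: le_trans (eK c) _; rewrite ler_pM2l.
(* This number of rounds exceeds [B / d], which contradicts [dB]. *)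
have := dB (Num.bound (B / d)); rewrite -mulr_natl -ler_pdivlMr//.
apply/negP; rewrite -ltNge; apply: archi_boundP.
by rewrite divr_ge0 ?(ltW d0)// (le_trans _ (dB 0)).
Qed.

End Escape.

(** * Player I's moves for odd k and beyond dimension two *)

Section PlayerI.
Variables (R : realType) (X : normedModType R) (k : nat).

Lemma not_keep_bounded_odd : odd k -> ~ dim_at_most X 1 ->
  ~ playerII_can_keep_bounded X k.
Proof.
move=> ok /independent_of_dim[e ind].
have [d d0 orth] := unit_orthogonal ind.
apply: (not_keep_bounded ind d0) => c.
(* Annihilating the column [c^T] means being orthogonal to [c]. *)
have [w [wc w1 dw]] := orth 1 c^T isT.
exists [tuple lincomb e w | _ < k]; split=> [j|bs]; first by rewrite tnth_mktuple.
exists ((\sum_(j < k) (-1) ^+ tnth bs j) *: w); split.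
- rewrite linearZ /= scaler_suml; apply: eq_bigr => j _ /=.
  by rewrite tnth_mktuple.
- by rewrite dotZl /dot wc mxE mulr0.
- rewrite dotZl dotZr mulrA -expr2 -[d]mul1r ler_pM//; first exact: ltW.
  exact: odd_sum_signs_sqr_ge1.
Qed.

Lemma not_keep_bounded_dim3 : (0 < k)%N -> ~ dim_at_most X 2 ->
  ~ playerII_can_keep_bounded X k.
Proof.
case: k => // k' _ /independent_of_dim[e ind].
have [d d0 orth] := unit_orthogonal ind.
apply: (not_keep_bounded ind d0) => c.
have [v [vc v1 dv]] := orth 1 c^T isT.
(* Two columns impose orthogonality to [c] and [v] at once; the three coordinates leave room for
   it. *)
have [w [/eqP + w1 dw]] := orth (1 + 1)%N (row_mx c^T v^T) isT.
rewrite mul_mx_row row_mx_eq0 => /andP[/eqP wc /eqP wv].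
exists [tuple if j == ord0 then lincomb e w else lincomb e v | j < k'.+1].
split=> [j|bs]; first by rewrite tnth_mktuple; case: ifP.
exists ((-1) ^+ tnth bs ord0 *: w +
  (\sum_(j < k') (-1) ^+ tnth bs (lift ord0 j)) *: v); split.
- rewrite linearD !linearZ /= scaler_suml /displacement big_ord_recl /=.
  rewrite tnth_mktuple eqxx; congr (_ + _); apply: eq_bigr => j _.
  by rewrite tnth_mktuple.
- by rewrite dotDl !dotZl /dot vc wc mxE !mulr0 addr0.
(* The squared length is [dot w w] plus a square times [dot v v]. *)
- rewrite dotDl !dotDr !dotZl !dotZr (dotC v) {2 3}/dot wv mxE !mulr0 addr0 add0r.
  rewrite !mulrA -!expr2 sqrr_sign mul1r (le_trans dw)// lerDl.
  by rewrite mulr_ge0 ?sqr_ge0// (le_trans (ltW d0)).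
Qed.

End PlayerI.

(* The hypothesis [Hdeg] removes exactly the instances (dimension at most 1 and
   k odd) in which the equivalence fails: on a line all the vectors of a round
   are equal up to sign, so Player II can keep every position within norm 1 of
   the origin whatever the parity of k, and in the zero space Player I has no
   legal move. *)
Theorem theorem5 (R : realType) (X : normedModType R) (k : nat)
    (Hk : (0 < k)%N) (Hdeg : ~ (dim_at_most X 1 /\ odd k)) :
  (playerII_can_keep_bounded X k <-> dim_at_most X 2 /\ ~~ odd k) /\
  (dim_at_most X 2 /\ ~~ odd k ->
     playerII_can_force k (fun p : nat -> X => forall i : nat, `|p i| <= 2)).
Proof.
have force2 : dim_at_most X 2 /\ ~~ odd k ->
    playerII_can_force k (fun p : nat -> X => forall i : nat, `|p i| <= 2).
  move=> [d2 ek]; apply: (@force_invariant _ _ _ (fun p => `|p| <= 2)).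
    by rewrite normr0.
  move=> p xs.
  exact: balance_even.
split; last exact: force2; split=> [kb|/force2[sigma sigma2]].
  have [ok|ek] := boolP (odd k).
    have [d1|nd1] := pselect (dim_at_most X 1); first by case: Hdeg.
    by case: (not_keep_bounded_odd ok nd1).
  split=> //; apply: contrapT => nd2; exact: not_keep_bounded_dim3 Hk nd2 kb.
exists sigma => play lp fp; exists 2; split=> // M M2 i _.
exact: le_trans (sigma2 _ lp fp i) (ltW M2).
Qed.
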